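(* Let $j\geq 2$ be an integer and let $n$ be a positive integer such that the sequence $n, T(n),\ldots,T^{j-1}(n)$ contains exactly one even term. Then at least one of the following holds: (1) $\displaystyle n \geq \frac{2^{j+1}}{3j^2} - 1$; (2) there exist an integer $k<j$ and an odd integer $b=T^k(n)+1$ such that the triple $(1,b,b+1)$ is a $\mu$-hit.
   Context: The Collatz map is $T(n)=(3n+1)/2$ if $n$ is odd and $T(n)=n/2$ if $n$ is even, with $T^0(n)=n$. The function $\mu:\mathbb{Z}_{\geq1}\to\mathbb{R}_{\geq 0}$ is defined by $\mu(p_1^{n_1}\cdots p_r^{n_r})=\log(p_1\cdots p_r)+\log(n_1\cdots n_r)$ for distinct primes $p_1,\ldots,p_r$ and positive integers $n_1,\ldots,n_r$ (natural logarithm; $\mu(1)=0$). A $\mu$-hit is a triple $(a,b,c)$ of positive integers with $a+b=c$, $\gcd(a,b)=1$ and $\log c>\mu(abc)$. *)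

(* Defs.v *)
From mathcomp Require Import all_boot all_order all_algebra.
From mathcomp Require Import reals exp.

Set Implicit Arguments.
Unset Strict Implicit.
Unset Printing Implicit Defensive.

Import Order.TTheory GRing.Theory Num.Theory.

Local Open Scope ring_scope.

Definition collatz (n : nat) : nat :=
  if odd n then (3 * n + 1)./2 else n./2.

(* Each factor [logn p m] with [p \in primes m] is the positive exponent of p
   in m; both products are empty when m = 1, so [mu 1 = 0]. The value at
   m = 0 is junk. *)
Definition mu (R : realType) (m : nat) : R :=
  ln (\prod_(p <- primes m) p)%N%:R + ln (\prod_(p <- primes m) logn p m)%N%:R.

Definition mu_hit (R : realType) (a b c : nat) : Prop :=
  [/\ [&& 0 < a, 0 < b & 0 < c]%N,
      (a + b = c)%N,
      coprime a b &
      mu R (a * b * c) < ln (c%:R : R)].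

(* Main.v *)
Require Import Defs.
From mathcomp Require Import all_boot all_order all_algebra.
From mathcomp Require Import reals exp.
From mathcomp Require Import zify.

Import Order.TTheory GRing.Theory Num.Theory.

(** An odd step sends [m + 1] to [3 (m + 1) / 2].  If the even term is
    [b - 1 = T^k(n)], then [b = 3^k q] with [n + 1 = 2^k q], and the
    [j - 1 - k] odd steps after it give [b + 1 = 2^(j-k) r].  Hence
    [exp (mu (b (b + 1))) <= 3 k q * 2 (j - k) r] when [0 < k]; if the triple is
    not a hit, then [2^(j-k) r = b + 1 <= 6 k (j - k) q r], so that
    [2^j <= 6 k (j - k) (n + 1) <= (3/2) j^2 (n + 1)]. *)

Local Open Scope nat_scope.

(** Working with the exponential of [mu] keeps all the estimates in [nat]. *)
Definition exp_mu (m : nat) : nat := \prod_(p <- primes m) (p * logn p m).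

Lemma exp_mu_gt0 m : 0 < exp_mu m.
Proof.
rewrite /exp_mu big_seq; apply: prodn_cond_gt0 => p p_m.
by rewrite muln_gt0 logn_gt0 p_m prime_gt0 //; move: p_m; rewrite mem_primes => /andP[].
Qed.

Lemma mu_ln_exp_mu (R : realType) m : mu R m = ln ((exp_mu m)%:R : R)%R.
Proof.
have := exp_mu_gt0 m.
rewrite /mu /exp_mu big_split muln_gt0 => /andP[p_gt0 e_gt0].
by rewrite natrM lnM ?posrE ?ltr0n.
Qed.

Lemma exp_mu_coprime x y : 0 < x -> 0 < y -> coprime x y ->
  exp_mu (x * y) = exp_mu x * exp_mu y.
Proof.
move=> x_gt0 y_gt0 co_xy.
have perm_xy : perm_eq (primes (x * y)) (primes x ++ primes y).
  apply: uniq_perm; rewrite ?cat_uniq ?primes_uniq //=.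
    by rewrite -coprime_has_primes // co_xy.
  by move=> p; rewrite mem_cat primesM.
rewrite /exp_mu (perm_big _ perm_xy) big_cat /=; congr (_ * _);
  apply: eq_big_seq => p; rewrite mem_primes => /and3P[_ _ p_dv].
  by rewrite (mulnC x) logn_Gauss // (coprime_dvdl p_dv).
by rewrite logn_Gauss // (coprime_dvdl p_dv) // coprime_sym.
Qed.

Lemma exp_muX p e : prime p -> 0 < e -> exp_mu (p ^ e) = p * e.
Proof.
move=> p_pr e_gt0.
by rewrite /exp_mu primesX // primes_prime // big_seq1 pfactorK.
Qed.

(** Prime by prime, p * e <= p ^ e, because e - 1 < p ^ (e - 1). *)
Lemma exp_mu_le m : 0 < m -> exp_mu m <= m.
Proof.
move=> m_gt0; rewrite {2}[m]prod_prime_decomp // prime_decompE big_map /=.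
rewrite /exp_mu !big_seq; apply: leq_prod => p p_m.
have e_gt0 : 0 < logn p m by rewrite logn_gt0.
have p_gt1 : 1 < p by move: p_m; rewrite mem_primes => /andP[/prime_gt1].
by rewrite -{2}(prednK e_gt0) expnS leq_mul2l -{1}(prednK e_gt0) ltn_expl ?orbT.
Qed.

(** Since p may divide q, write q = p ^ e * q' with q' coprime to p. The factor at p is then p * (k
    + e), and k + e <= k * p ^ e because e < p ^ e and 1 <= k. *)
Lemma exp_mu_pfactor_le p k q : prime p -> 0 < k -> 0 < q ->
  exp_mu (p ^ k * q) <= p * k * q.
Proof.
move=> p_pr k_gt0 q_gt0.
have [q' co_pq' def_q] := pfactor_coprime p_pr q_gt0.
set e := logn p q in def_q.
have q'_gt0 : 0 < q' by move: q_gt0; rewrite def_q muln_gt0 => /andP[].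
have -> : p ^ k * q = p ^ (k + e) * q' by rewrite def_q expnD; lia.
have pke_gt0 : 0 < p ^ (k + e) by rewrite expn_gt0 prime_gt0.
rewrite exp_mu_coprime ?coprimeXl // exp_muX ?addn_gt0 ?k_gt0 //.
rewrite def_q (mulnC q') mulnA; apply: leq_mul; last exact: exp_mu_le.
rewrite -mulnA leq_mul2l; apply/orP; right.
have : e < p ^ e by rewrite ltn_expl ?prime_gt1.
nia.
Qed.

Lemma iter_collatz_odd m k : count (fun i => ~~ odd i) (traject collatz m k) = 0 ->
  exists q, m + 1 = 2 ^ k * q /\ iter k collatz m + 1 = 3 ^ k * q.
Proof.
elim: k => [|k IHk]; first by exists (m + 1); rewrite !mul1n.
rewrite trajectSr -cats1 count_cat /= addn0 => /eqP.
rewrite addn_eq0 eqb0 negbK => /andP[/eqP/IHk[q [eq_m eq_it]] odd_it].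
(* The k-th iterate is odd, so 3 ^ k * q is even, hence so is q: this supplies the next factor 2 of
   m + 1. *)
have even_q : ~~ odd q.
  have := congr1 odd eq_it.
  by rewrite oddD odd_it oddM oddX orbT /=; case: odd.
exists q./2; have := odd_double_half q; rewrite (negbTE even_q) -muln2 => def_q.
rewrite !expnS; split; first by rewrite eq_m -{1}def_q; nia.
rewrite {1}/collatz odd_it; move: eq_it; rewrite -{1}def_q; nia.
Qed.

Lemma one_even_collatz j n :
  count (fun m => ~~ odd m) (traject collatz n j) = 1 ->
  exists k q r, [/\ k < j, ~~ odd (iter k collatz n), n + 1 = 2 ^ k * q,
    iter k collatz n + 1 = 3 ^ k * q &
    iter k collatz n + 2 = 2 ^ (j - k) * r].
Proof.
move=> cnt1.
have /hasP[x /trajectP[k ltkj ->] even_k] :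
    has (fun m => ~~ odd m) (traject collatz n j) by rewrite has_count cnt1.
(* Cut the trajectory at its even term: the k terms before it and the j - k - 1 terms after it are
   all odd. *)
move: cnt1; have -> : j = k + (j - k).-1.+1 by lia.
rewrite trajectD count_cat trajectS /= even_k => cnt1.
have [|q [eq_n eq_k]] := @iter_collatz_odd n k; first by lia.
have [|r [eq_r _]] := @iter_collatz_odd (collatz (iter k collatz n)) (j - k).-1.
  by lia.
exists k, q, r; split=> //; first by lia.
(* For the even term x, the next term plus one is x / 2 + 1 = 2 ^ (j - k - 1) * r; doubling gives x
   + 2. *)
move: eq_r; rewrite {1}/collatz (negbTE even_k).
have -> : k + (j - k).-1.+1 - k = (j - k).-1.+1 by lia.
rewrite expnS; have := odd_double_half (iter k collatz n).
rewrite (negbTE even_k) -muln2; lia.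
Qed.

Lemma hit_or_bound j k n q r : 2 <= j -> k < j -> 0 < r -> n + 1 = 2 ^ k * q ->
    3 ^ k * q + 1 = 2 ^ (j - k) * r ->
  exp_mu (3 ^ k * q * (3 ^ k * q + 1)) < 3 ^ k * q + 1 \/
  2 ^ j.+1 <= 3 * j ^ 2 * (n + 1).
Proof.
move=> j_ge2 ltkj r_gt0 eq_n eq_b.
have q_gt0 : 0 < q by case: q eq_n {eq_b} => [|//]; rewrite muln0 addn1.
have [hit|no_hit] := ltnP (exp_mu (3 ^ k * q * (3 ^ k * q + 1))) (3 ^ k * q + 1).
  by left.
right; move: no_hit.
rewrite exp_mu_coprime ?muln_gt0 ?expn_gt0 ?q_gt0 ?addn1 ?coprimenS //.
rewrite -addn1 eq_b => no_hit.
have muS : exp_mu (2 ^ (j - k) * r) <= 2 * (j - k) * r.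
  by apply: exp_mu_pfactor_le; rewrite ?subn_gt0.
have eq_2j : 2 ^ j = 2 ^ k * 2 ^ (j - k) by rewrite -expnD subnKC // ltnW.
(* The constant c will be 1 for k = 0 and 3 * k otherwise. Cancel r, then multiply by 2 ^ k and use
   2 ^ k * q = n + 1. *)
have bound c : exp_mu (3 ^ k * q) <= c * q -> 2 ^ j <= 2 * c * (j - k) * (n + 1).
  move=> mu_b; rewrite eq_2j eq_n.
  have : 2 ^ (j - k) * r <= 2 * c * (j - k) * q * r.
    by apply: leq_trans no_hit (leq_trans (leq_mul mu_b muS) _); nia.
  rewrite leq_pmul2r // => le_2jk; nia.
rewrite expnS; have [k0|k_gt0] := posnP k.
  (* No power of 3 is available here, but 2 ^ (j + 1) <= 4 * j * (n + 1) suffices, as 4 <= 3 * j. *)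
  have := bound 1; rewrite k0 expn0 !mul1n subn0 => /(_ (exp_mu_le _ q_gt0)).
  nia.
have := bound _ (exp_mu_pfactor_le 3 _ _ isT k_gt0 q_gt0).
(* AM-GM gives 4 * k * (j - k) <= j ^ 2, which turns the factor 12 * k * (j - k) into 3 * j ^ 2. *)
have := (nat_AGM2 k (j - k)).1; rewrite subnKC ?(ltnW ltkj) // => amgm.
nia.
Qed.

Local Open Scope ring_scope.

Theorem theorem2 (R : realType) (j n : nat) (hj : (2 <= j)%N) (hn : (0 < n)%N)
    (hone : count (fun m => ~~ odd m) (traject collatz n j) = 1%N) :
  (n%:R : R) >= 2 ^+ j.+1 / (3 * j%:R ^+ 2) - 1 \/
  exists k b : nat,
    [/\ (k < j)%N, b = (iter k collatz n + 1)%N, odd b & mu_hit R 1 b (b + 1)].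
Proof.
have [k [q [r [ltkj even_k eq_n eq_k eq_r]]]] := one_even_collatz _ _ hone.
have r_gt0 : (0 < r)%N by case: r eq_r => [|//]; rewrite muln0 addn2.
have eq_b : (3 ^ k * q + 1 = 2 ^ (j - k) * r)%N by rewrite -eq_k -addnA.
have [hit|le_n] := hit_or_bound _ _ _ _ _ hj ltkj r_gt0 eq_n eq_b; [right|left].
  exists k, (iter k collatz n + 1)%N; split=> //; first by rewrite addn1 /= even_k.
  split; rewrite ?coprime1n ?(addnC 1%N) ?addn_gt0 ?orbT // mul1n eq_k.
  by rewrite mu_ln_exp_mu ltr_ln ?posrE ?ltr0n ?ltr_nat ?exp_mu_gt0 ?addn_gt0 ?orbT.
have j_gt0 : (0 < j)%N by apply: leq_trans hj.
rewrite lerBlDr ler_pdivrMr ?mulr_gt0 ?exprn_gt0 ?ltr0n //.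
by rewrite natr1 -!natrX -!natrM ler_nat mulnC -(addn1 n).
Qed.
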